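(* Let $H\subseteq (0,\infty)$ be a positive rational cone generated by a $\mathbb{Q}$-linearly independent infinite subset of $(0,\infty)$. Then there exists a subadditive bijection $f:H\to H$ such that $$\liminf_{x\to 0}f(x)=0\quad\text{and}\quad \limsup_{x\to 0}f(x)=1,$$ where the limits are taken along $x\in H$.
   Context: A positive rational cone is a subset $H\subseteq(0,\infty)$ which is stable under finite (nonempty) sums and under multiplication by positive rationals. The positive rational cone generated by a set $B\subseteq(0,\infty)$ is the set of all finite nonempty sums $\sum_i r_i b_i$ with $r_i$ positive rationals and $b_i\in B$. A function $f:H\to H$ is subadditive if $f(x+y)\le f(x)+f(y)$ for all $x,y\in H$. *)

(* Defs.v *)
From mathcomp Require Import all_boot all_order all_algebra.
From mathcomp Require Import all_classical all_reals all_analysis.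
Import Order.TTheory GRing.Theory Num.Theory.
Import numFieldNormedType.Exports.

Set Implicit Arguments.
Unset Strict Implicit.
Unset Printing Implicit Defensive.

Local Open Scope classical_set_scope.
Local Open Scope ring_scope.

(* Nonempty finite families are indexed by 'I_n.+1; [ratr] embeds rat in R. *)

Definition positive_rational_cone (R : realType) (H : set R) : Prop :=
  [/\ forall x, H x -> 0 < x,
      forall (n : nat) (x : 'I_n.+1 -> R),
        (forall i, H (x i)) -> H (\sum_(i < n.+1) x i)
    & forall (q : rat) (x : R), 0 < q -> H x -> H (ratr q * x)].

Definition generated_cone (R : realType) (B : set R) : set R :=
  [set x | exists (n : nat) (r : 'I_n.+1 -> rat) (b : 'I_n.+1 -> R),
     [/\ forall i, 0 < r i,
         forall i, B (b i)
       & x = \sum_(i < n.+1) ratr (r i) * b i]].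

(* [free] is only available in finite-dimensional spaces. *)
Definition rat_linearly_independent (R : realType) (B : set R) : Prop :=
  forall (n : nat) (b : 'I_n -> R) (q : 'I_n -> rat),
    injective b -> (forall i, B (b i)) ->
    \sum_(i < n) ratr (q i) * b i = 0 -> forall i, q i = 0.

Definition subadditive_on (R : realType) (H : set R) (f : R -> R) : Prop :=
  forall x y, H x -> H y -> f (x + y) <= f x + f y.

(* Main.v *)
(* Fix distinct e_0, e_1, ... in B and give e_(2i+2) the weight w_i = 2^-(i+1). For x in H let S(x)
   be the set of those i for which e_(2i+2) occurs in x, so that S(x + y) is the union of S(x) and
   S(y). Call u admissible for x if max w <= u <= max w + min w over S(x), or if S(x) is empty and
   1/2 <= u <= 1. Since min w over a union is at most max w over either part, any f with f(x) - x
   admissible for every x is subadditive; moreover f(x) <= x + 1, and f(x) <= x + 2 w_n on the ray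
   of e_(2n+2), which gives the limit 0. On the ray of e_1 the excess f(x) - x is in addition
   forced to tend to 1.
   By the Cantor-Bernstein construction, a bijection f subject to such a relation between x and
   f(x) exists as soon as the relation contains the graph of an injection H -> H and the transpose
   of another one. The first is x |-> x + q e_0, with q depending only on the coordinates of x
   other than that of e_0. The second sends t to r (s(t) + e_0) + q e_(2n+2), where s is induced by
   an injection B -> B avoiding every e_(2i): then S = {n}, the rational r is read off the
   coordinate at e_0 and t off the remaining ones, while n, r and q are free to tune the size. *)

Require Import Defs.
From mathcomp Require Import all_boot all_order all_algebra.
From mathcomp Require Import all_classical all_reals all_analysis.
From mathcomp Require Import lra.
Import Order.TTheory GRing.Theory Num.Theory.
Import numFieldNormedType.Exports.

Local Open Scope classical_set_scope.
Local Open Scope ring_scope.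

(** * Cantor-Bernstein with a relation to respect *)

Lemma Cantor_Bernstein_rel (T : choiceType) (A : set T) (P : T -> T -> Prop)
    (g h : T -> T) :
    set_fun A A g -> set_inj A g -> (forall x, A x -> P x (g x)) ->
    set_fun A A h -> set_inj A h -> (forall t, A t -> P (h t) t) ->
  exists2 f : T -> T, set_bij A A f & forall x, A x -> P x (f x).
Proof.
move=> gA gI gP hA hI hP.
pose C := [set x | exists n y, [/\ A y, ~ (h @` A) y & x = iter n (h \o g) y]].
pose f x := if x \in C then g x else xget x [set t | A t /\ h t = x].
have iterA n y : A y -> A (iter n (h \o g) y).
  by move=> Ay; elim: n => //= n IH; exact/hA/gA.
have fC x : C x -> f x = g x by move=> Cx; rewrite /f mem_set.
have fN x : A x -> ~ C x -> A (f x) /\ h (f x) = x.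
  move=> Ax NCx; rewrite /f memNset//; case: xgetP => [t _ //|no].
  exfalso; apply: NCx; exists 0%N, x; split=> // -[t At htx].
  exact: (no t).
have hgC x : C x -> C (h (g x)).
  by move=> [n [y [Ay Ny ->]]]; exists n.+1, y.
exists f; last first.
  move=> x Ax; have [Cx|NCx] := pselect (C x); first by rewrite fC//; exact: gP.
  by have [Af {1}<-] := fN x Ax NCx; exact: hP.
split.
- move=> x Ax; have [Cx|NCx] := pselect (C x); first by rewrite /= fC//; exact: gA.
  by have [] := fN x Ax NCx.
- move=> x y /set_mem Ax /set_mem Ay.
  have [Cx|NCx] := pselect (C x); have [Cy|NCy] := pselect (C y).
  + by rewrite !fC//; apply: gI; rewrite inE.
  + rewrite fC// => fxy; have [_] := fN y Ay NCy.
    by rewrite -fxy => hgx; exfalso; apply: NCy; rewrite -hgx; exact: hgC.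
  + rewrite (fC y)// => fxy; have [_] := fN x Ax NCx.
    by rewrite fxy => hgx; exfalso; apply: NCx; rewrite -hgx; exact: hgC.
  + by move=> fxy; have [_ <-] := fN x Ax NCx; have [_ <-] := fN y Ay NCy; rewrite fxy.
- move=> t At; have Aht : A (h t) by exact: hA.
  (* If [h t] lies in [C], its orbit has made at least one step, as [h t] is in the image of [h];
     cancelling [h] exhibits [t] as a value of [g] on [C]. *)
  have [[[|n] [y [Ay Ny /= hty]]]|NC] := pselect (C (h t)).
  + by exfalso; apply: Ny; exists t.
  + exists (iter n (h \o g) y); first exact: iterA.
    rewrite fC; last by exists n, y.
    apply: hI; rewrite ?inE//; first by apply: gA; exact: iterA.
  + exists (h t) => //; have [Af] := fN _ Aht NC.
    by move=> E; apply: hI; rewrite ?inE.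
Qed.

(** * Formal combinations and their coefficients *)

(* A formal combination: the pair [(r, b)] stands for the term [r b]. *)
Definition combo {R : realType} (l : seq (rat * R)) : R :=
  \sum_(p <- l) ratr p.1 * p.2.

Definition coef {R : realType} (l : seq (rat * R)) (b : R) : rat :=
  \sum_(p <- l | p.2 == b) p.1.

Definition scale_combo {R : realType} (q : rat) (l : seq (rat * R)) :=
  [seq (q * p.1, p.2) | p <- l].

Definition positive_combo {R : realType} (B : set R) (l : seq (rat * R)) :=
  forall p, p \in l -> 0 < p.1 /\ B p.2.

Lemma combo_cat {R : realType} (l l' : seq (rat * R)) :
  combo (l ++ l') = combo l + combo l'.
Proof. by rewrite /combo big_cat. Qed.

Lemma coef_cat {R : realType} (l l' : seq (rat * R)) b :
  coef (l ++ l') b = coef l b + coef l' b.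
Proof. by rewrite /coef big_cat. Qed.

Lemma combo_scale {R : realType} q (l : seq (rat * R)) :
  combo (scale_combo q l) = ratr q * combo l.
Proof.
rewrite /combo big_map mulr_sumr; apply: eq_bigr => p _ /=.
by rewrite rmorphM mulrA.
Qed.

Lemma coef_scale {R : realType} q (l : seq (rat * R)) b :
  coef (scale_combo q l) b = q * coef l b.
Proof. by rewrite /coef big_map mulr_sumr. Qed.

(** Collecting equal vectors makes the family injective, as linear independence demands. *)
Lemma combo_coef {R : realType} (l : seq (rat * R)) :
  combo l = \sum_(b <- undup [seq p.2 | p <- l]) ratr (coef l b) * b.
Proof.
under eq_bigr => b _ do rewrite /coef rmorph_sum mulr_suml.
rewrite (exchange_big_dep xpredT)//= /combo.
apply: eq_big_seq => p pl.
rewrite (eq_bigl (fun b => b == p.2)); last by move=> b; rewrite eq_sym.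
by rewrite -big_filter filter_pred1_uniq ?undup_uniq ?mem_undup ?map_f// big_seq1.
Qed.

Lemma coef_notin {R : realType} (l : seq (rat * R)) b :
  b \notin [seq p.2 | p <- l] -> coef l b = 0.
Proof.
move=> bl; rewrite /coef big_seq_cond big1// => p /andP[pl /eqP pb].
by move: bl; rewrite -pb map_f.
Qed.

Lemma combo_eq0 {R : realType} (B : set R) (l : seq (rat * R)) :
  rat_linearly_independent B -> (forall p, p \in l -> B p.2) ->
  combo l = 0 -> forall b, coef l b = 0.
Proof.
move=> Bfree lB l0 b; set s := undup [seq p.2 | p <- l].
have [bs|] := boolP (b \in s); last by rewrite mem_undup => /coef_notin.
have := Bfree (size s) (fun i => nth 0 s i) (fun i => coef l (nth 0 s i)).
have sB c : c \in s -> B c by rewrite mem_undup => /mapP[p /lB ? ->].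
have bsz : (index b s < size s)%N by rewrite index_mem.
move=> /(_ _ _ _ (Ordinal bsz)) /=; rewrite nth_index//; apply.
- by move=> i j /eqP; rewrite nth_uniq ?undup_uniq// => /eqP/val_inj.
- by move=> i; apply: sB; exact: mem_nth.
- by rewrite -(big_mkord xpredT (fun i => ratr (coef l (nth 0 s i)) * nth 0 s i))
    -(big_nth 0 xpredT (fun c => ratr (coef l c) * c)) -combo_coef.
Qed.

(** Independence is applied to the formal difference [l ++ scale_combo (-1) l']; its coefficients
    may be negative, which is why [combo_eq0] asks for no sign. *)
Lemma combo_inj {R : realType} (B : set R) (l l' : seq (rat * R)) :
  rat_linearly_independent B ->
  positive_combo B l -> positive_combo B l' ->
  combo l = combo l' <-> coef l =1 coef l'.
Proof.
move=> Bfree lB l'B; have E b : coef (l ++ scale_combo (-1) l') b = coef l b - coef l' b.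
  by rewrite coef_cat coef_scale mulN1r.
have E' : combo (l ++ scale_combo (-1) l') = combo l - combo l'.
  by rewrite combo_cat combo_scale rmorphN1 mulN1r.
split=> [ll' b|ll'].
  apply/eqP; rewrite -subr_eq0 -E; apply/eqP; apply: (combo_eq0 B) => //.
    move=> p; rewrite mem_cat => /orP[/lB[]//|/mapP[p' /l'B[_ ?] ->//]].
  by rewrite E' ll' subrr.
apply/eqP; rewrite -subr_eq0 -E' combo_coef big1// => b _.
by rewrite E ll' subrr rmorph0 mul0r.
Qed.

(** * The generated cone and its coordinates *)

Lemma generated_coneP {R : realType} (B : set R) x :
  generated_cone B x <->
  exists l, [/\ l != [::], positive_combo B l & x = combo l].
Proof.
split=> [[n [r [b [r0 Bb ->]]]]|[l [l0 lB ->]]].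
  exists [seq (r i, b i) | i <- enum 'I_n.+1]; split.
  - by rewrite -size_eq0 size_map size_enum_ord.
  - by move=> _ /mapP[i _ ->] /=; split; [exact: r0|exact: Bb].
  - by rewrite /combo big_map big_enum.
case: l l0 lB => // p l _ lB; exists (size l).
exists (fun i => (nth p (p :: l) i).1), (fun i => (nth p (p :: l) i).2).
have plB (i : 'I_(size l).+1) := lB _ (mem_nth p (ltn_ord i : (i < size (p :: l))%N)).
split; [by move=> i; case: (plB i)|by move=> i; case: (plB i)|].
rewrite /combo (big_nth p) /=.
by rewrite (big_mkord xpredT (fun i => ratr (nth p (p :: l) i).1 * (nth p (p :: l) i).2)).
Qed.

(** An arbitrary choice: for independent [B], all positive decompositions of a point have the same
    coefficients, so [coord] does not depend on it. *)
Definition decomposition {R : realType} (B : set R) (x : R) : seq (rat * R) :=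
  xget [::] [set l | [/\ l != [::], positive_combo B l & x = combo l]].

Lemma decompositionP {R : realType} (B : set R) x : generated_cone B x ->
  [/\ decomposition B x != [::], positive_combo B (decomposition B x)
    & x = combo (decomposition B x)].
Proof.
move=> /generated_coneP[l lP]; rewrite /decomposition.
by case: xgetP => [l' _ //|/(_ l)].
Qed.

Definition coord {R : realType} (B : set R) (x : R) (b : R) : rat :=
  coef (decomposition B x) b.

Lemma coordE {R : realType} (B : set R) l b :
  rat_linearly_independent B -> l != [::] -> positive_combo B l ->
  coord B (combo l) b = coef l b.
Proof.
move=> Bfree l0 lB; have Hl : generated_cone B (combo l).
  by apply/generated_coneP; exists l.
have [_ dB dE] := decompositionP _ _ Hl.
by apply: (combo_inj B _ _ Bfree dB lB).1; rewrite -dE.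
Qed.

Lemma cone_ind {R : realType} (B : set R) (P : R -> Prop) :
  (forall l, l != [::] -> positive_combo B l -> P (combo l)) ->
  forall x, generated_cone B x -> P x.
Proof. by move=> Pl x /generated_coneP[l [l0 lB ->]]; exact: Pl. Qed.

Lemma positive_combo_cat {R : realType} (B : set R) l l' :
  positive_combo B l -> positive_combo B l' -> positive_combo B (l ++ l').
Proof. by move=> lB l'B p; rewrite mem_cat => /orP[/lB|/l'B]. Qed.

Lemma positive_combo_scale {R : realType} (B : set R) q l : 0 < q ->
  positive_combo B l -> positive_combo B (scale_combo q l).
Proof. by move=> q0 lB _ /mapP[p /lB[p0 pB] ->]; rewrite mulr_gt0. Qed.

Lemma coneD {R : realType} (B : set R) x y :
  generated_cone B x -> generated_cone B y -> generated_cone B (x + y).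
Proof.
move=> /generated_coneP[l [l0 lB ->]] /generated_coneP[l' [l'0 l'B ->]].
apply/generated_coneP; exists (l ++ l'); rewrite combo_cat; split=> //.
  by case: l l0 {lB}.
exact: positive_combo_cat.
Qed.

Lemma coneZ {R : realType} (B : set R) q x : 0 < q ->
  generated_cone B x -> generated_cone B (ratr q * x).
Proof.
move=> q0 /generated_coneP[l [l0 lB ->]].
apply/generated_coneP; exists (scale_combo q l); rewrite combo_scale; split=> //.
  by case: l l0 {lB}.
exact: positive_combo_scale.
Qed.

Lemma cone_base {R : realType} (B : set R) : B `<=` generated_cone B.
Proof.
move=> b Bb; apply/generated_coneP; exists [:: (1, b)]; split => //.
  by move=> p; rewrite inE => /eqP ->.
by rewrite /combo big_seq1 rmorph1 mul1r.
Qed.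

Lemma cone_gt0 {R : realType} (B : set R) x :
  (forall b, B b -> 0 < b) -> generated_cone B x -> 0 < x.
Proof.
move=> B0; move: x; apply: cone_ind => -[//|p l] _ lB; rewrite /combo big_cons.
apply: ltr_wpDr.
  rewrite big_seq sumr_ge0// => p' p'l; have [] := lB p'; first by rewrite inE p'l orbT.
  by move=> r0 /B0 b0; rewrite mulr_ge0 ?ler0q ?ltW.
by have [] := lB p (mem_head _ _) => r0 /B0 b0; rewrite mulr_gt0// ltr0q.
Qed.

Lemma coordD {R : realType} (B : set R) x y b :
  rat_linearly_independent B -> generated_cone B x -> generated_cone B y ->
  coord B (x + y) b = coord B x b + coord B y b.
Proof.
move=> Bfree /generated_coneP[l [l0 lB ->]] /generated_coneP[l' [l'0 l'B ->]].
rewrite -combo_cat !coordE ?coef_cat//; first by case: l l0 {lB}.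
exact: positive_combo_cat.
Qed.

Lemma coordZ {R : realType} (B : set R) q x b :
  rat_linearly_independent B -> 0 < q -> generated_cone B x ->
  coord B (ratr q * x) b = q * coord B x b.
Proof.
move=> Bfree q0 /generated_coneP[l [l0 lB ->]].
rewrite -combo_scale !coordE ?coef_scale//; first by case: l l0 {lB}.
exact: positive_combo_scale.
Qed.

Lemma coord_base {R : realType} (B : set R) b b' :
  rat_linearly_independent B -> B b -> coord B b b' = (b == b')%:R.
Proof.
move=> Bfree Bb.
have -> : coord B b b' = coord B (combo [:: (1, b)]) b'.
  by rewrite /combo big_seq1 rmorph1 mul1r.
rewrite coordE//; last by move=> p; rewrite inE => /eqP ->.
by rewrite /coef big_cons big_nil/= addr0; case: eqP.
Qed.

Lemma coord_ge0 {R : realType} (B : set R) x b :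
  generated_cone B x -> 0 <= coord B x b.
Proof.
move=> /decompositionP[_ dB _]; rewrite /coord /coef big_seq_cond sumr_ge0//.
by move=> p /andP[/dB[/ltW]].
Qed.

Lemma coord_finite_support {R : realType} (B : set R) x :
  exists s : seq R, forall b, 0 < coord B x b -> b \in s.
Proof.
exists [seq p.2 | p <- decomposition B x] => b; apply: contraTT => /coef_notin.
by rewrite /coord => ->.
Qed.

Lemma coord_inj {R : realType} (B : set R) x y : rat_linearly_independent B ->
  generated_cone B x -> generated_cone B y ->
  (forall b, B b -> coord B x b = coord B y b) -> x = y.
Proof.
move=> Bfree /decompositionP[_ xB xE] /decompositionP[_ yB yE] xy.
rewrite xE yE; apply/(combo_inj B) => // b.
have [Bb|NBb] := pselect (B b); first exact: xy.
rewrite !coef_notin//; apply/negP => /mapP[p].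
  by move=> /yB[_ ?] pb; apply: NBb; rewrite pb.
by move=> /xB[_ ?] pb; apply: NBb; rewrite pb.
Qed.

(** * Maps of the cone induced by maps of the basis *)

(** For independent [B], this is the rational-linear extension of [s] from [B] to the cone. *)
Definition cone_map {R : realType} (B : set R) (s : R -> R) (x : R) : R :=
  combo [seq (p.1, s p.2) | p <- decomposition B x].

Lemma positive_combo_map {R : realType} (B : set R) s l :
  set_fun B B s -> positive_combo B l ->
  positive_combo B [seq (p.1, s p.2) | p <- l].
Proof. by move=> sB lB _ /mapP[p /lB[? ?] ->]; split=> //=; exact: sB. Qed.

Lemma cone_map_cone {R : realType} (B : set R) s x : set_fun B B s ->
  generated_cone B x -> generated_cone B (cone_map B s x).
Proof.
move=> sB /decompositionP[d0 dB _]; apply/generated_coneP.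
exists [seq (p.1, s p.2) | p <- decomposition B x]; split=> //.
  by rewrite -size_eq0 size_map size_eq0.
exact: positive_combo_map.
Qed.

Lemma coord_cone_map {R : realType} (B : set R) s x b :
  rat_linearly_independent B -> set_fun B B s -> set_inj B s ->
  generated_cone B x -> B b -> coord B (cone_map B s x) (s b) = coord B x b.
Proof.
move=> Bfree sB sI /decompositionP[d0 dB _] Bb.
rewrite coordE//; [|by rewrite -size_eq0 size_map size_eq0|exact: positive_combo_map].
rewrite /coord /coef big_map/= big_seq_cond [RHS]big_seq_cond.
apply: eq_bigl => p; case: (boolP (p \in _)) => //= /dB[_ pB].
by apply/eqP/eqP => [/sI|->//]; apply; rewrite inE.
Qed.

Lemma coord_cone_map0 {R : realType} (B : set R) s x b :
  rat_linearly_independent B -> set_fun B B s ->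
  generated_cone B x -> (forall b', B b' -> s b' <> b) ->
  coord B (cone_map B s x) b = 0.
Proof.
move=> Bfree sB /decompositionP[d0 dB _] Nb.
rewrite coordE//; [|by rewrite -size_eq0 size_map size_eq0|exact: positive_combo_map].
apply: coef_notin; apply/negP => /mapP[_ /mapP[p /dB[_ pB] ->] /= bp].
exact: (Nb p.2).
Qed.

(** * Criteria for the two limits at 0 *)

(** The lower limit is a supremum of infima over neighbourhoods: [H] itself has infimum at least 0,
    and every neighbourhood contains points with arbitrarily small values. *)
Lemma limf_einf_cone_eq0 {R : realType} (H : set R) (f : R -> R) :
  (forall x, H x -> 0 < x) -> (forall x, H x -> 0 <= f x) ->
  (forall d : R, 0 < d -> exists x, [/\ H x, x < d & f x < d]) ->
  limf_einf (fun x : R => (f x)%:E) (within H (nbhs (0 : R))) = 0%E.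
Proof.
move=> H0 f0 fd; rewrite limf_einfE; apply/eqP; rewrite eq_le; apply/andP; split.
  apply/ereal_supP => _ [V /nbhs_ballP[d/= d0 dV] <-].
  apply/lee_addgt0Pr => k k0; rewrite add0e.
  have [x [Hx xd fxk]] : exists x, [/\ H x, x < Num.min d k & f x < Num.min d k].
    by apply: fd; rewrite lt_min d0.
  move: xd fxk; rewrite !lt_min => /andP[xd _] /andP[_ fxk].
  apply: ge_ereal_inf; exists (f x)%:E; last by rewrite lee_fin ltW.
  exists x => //; apply: dV => //; rewrite /ball/= sub0r normrN gtr0_norm//.
  exact: H0.
apply: le_ereal_sup_tmp; exists (ereal_inf [set (f x)%:E | x in H]).
  by exists H => //; exact: nearW.
by apply/ereal_infP => _ [x Hx <-]; rewrite lee_fin f0.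
Qed.

Lemma limf_esup_cone_eq1 {R : realType} (H : set R) (f : R -> R) :
  (forall x, H x -> 0 < x) -> (forall x, H x -> f x <= x + 1) ->
  (forall d : R, 0 < d -> exists x, [/\ H x, x < d & 1 - d <= f x]) ->
  limf_esup (fun x : R => (f x)%:E) (within H (nbhs (0 : R))) = 1%E.
Proof.
move=> H0 f1 fd; rewrite limf_esupE; apply/eqP; rewrite eq_le; apply/andP; split.
  apply/lee_addgt0Pr => k k0.
  apply: ge_ereal_inf; exists (ereal_sup [set (f x)%:E | x in H `&` ball 0 k]).
    exists (H `&` ball 0 k) => //; apply/nbhs_ballP.
    by exists k => //=.
  apply: ge_ereal_sup => _ [x [Hx +] <-]; rewrite /ball/= sub0r normrN => xk.
  rewrite -EFinD lee_fin (le_trans (f1 _ Hx))// addrC lerD2l.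
  by rewrite ltW// (le_lt_trans (ler_norm _)).
apply/ereal_infP => _ [V /nbhs_ballP[d/= d0 dV] <-].
apply/lee_addgt0Pr => k k0.
have [x [Hx xd fxk]] : exists x, [/\ H x, x < Num.min d k & 1 - Num.min d k <= f x].
  by apply: fd; rewrite lt_min d0.
move: xd; rewrite lt_min => /andP[xd _].
apply: (@le_trans _ _ ((f x)%:E + k%:E)%E).
  rewrite -EFinD lee_fin -lerBlDr (le_trans _ fxk)// lerB// ge_min lexx orbT//.
rewrite leeD2r//; apply: ereal_sup_ubound; exists x => //; apply: dV => //.
by rewrite /ball/= sub0r normrN gtr0_norm//; exact: H0.
Qed.

(** * An injection of the basis that frees infinitely many elements *)

(** Hilbert's hotel: [e i] moves to [e i.*2.+1] and everything else stays. *)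
Lemma injective_shift (T : eqType) (B : set T) (e : nat -> T) :
  (forall i, B (e i)) -> injective e ->
  exists s : T -> T, [/\ set_fun B B s, set_inj B s
    & forall b i, s b <> e i.*2].
Proof.
move=> eB eI; pose s x :=
  if pselect (exists i, e i = x) then e (xget 0%N [set i | e i = x]).*2.+1 else x.
have se i : s (e i) = e i.*2.+1.
  rewrite /s; case: pselect => [?|[]] /=; last by exists i.
  by have /eI -> : e (xget 0%N [set j | e j = e i]) = e i by exact: (xgetI 0%N (erefl : [set j | e j = e i] i)).
have sN x : ~ (exists i, e i = x) -> s x = x by rewrite /s; case: pselect.
exists s; split.
- move=> x Bx /=; have [[i <-]|/sN->//] := pselect (exists i, e i = x).
  by rewrite se.
- move=> x y _ _.
  have [[i <-]|Nx] := pselect (exists i, e i = x);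
    have [[j <-]|Ny] := pselect (exists j, e j = y); rewrite ?se ?sN//.
  + by move=> /eI/eqP; rewrite eqSS => /eqP/double_inj ->.
  + by move=> eiy; exfalso; apply: Ny; exists i.*2.+1.
  + by move=> eix; exfalso; apply: Nx; exists j.*2.+1.
- move=> x i; have [[j <-]|Nx] := pselect (exists j, e j = x).
    by rewrite se => /eI/(congr1 odd)/=; rewrite !odd_double.
  by rewrite sN// => eix; apply: Nx; exists i.*2.
Qed.

(** * Weights and admissible excesses *)

Definition weight {R : realType} (i : nat) : R := 1 / 2 ^+ i.+1.

Lemma weight_gt0 {R : realType} i : 0 < weight i :> R.
Proof. by rewrite divr_gt0// exprn_gt0. Qed.

Lemma weight_le {R : realType} i j : (i <= j)%N -> weight j <= weight i :> R.
Proof.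
move=> ij; rewrite /weight !div1r lef_pV2 ?posrE ?exprn_gt0//.
by rewrite ler_eXn2l// ltr1n.
Qed.

Lemma weight_le_half {R : realType} i : weight i <= 1 / 2 :> R.
Proof. by have := @weight_le R 0 i (leq0n i); rewrite {2}/weight expr1. Qed.

Lemma weight_lt {R : realType} (d : R) : 0 < d -> exists n, weight n < d.
Proof.
move=> d0; have [n _ /(_ n.+1)] := near_infty_natSinv_expn_lt (PosNum d0).
by move=> /(_ (leqnSn n)) nd; exists n.
Qed.

(* [S] is the set of the weighted basis elements occurring in a point [x], [c] is the coordinate
   of [x] at one fixed unweighted basis element, and [u] is the excess [f x - x]. The clause on
   [c] only serves to make the excess tend to [1] along the ray of that element. *)
Definition admissible {R : realType} (S : nat -> bool) (c : rat) (u : R) : Prop :=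
  (forall i, S i -> weight i <= u) /\
  ((exists i, S i /\ forall j, S j -> u <= weight i + weight j) \/
   [/\ forall i, ~~ S i, 1 / 2 <= u, u <= 1 & 0 < c -> 1 - ratr c <= u]).

Lemma admissible_le1 {R : realType} S c (u : R) : admissible S c u -> u <= 1.
Proof.
move=> [_ [[i [Si /(_ i Si)]]|[]//]].
by have := @weight_le_half R i; lra.
Qed.

Lemma admissible_ge_half {R : realType} S c (u : R) :
  admissible S c u -> (forall i, ~~ S i) -> 1 / 2 <= u.
Proof. by move=> [_ [[i [Si _]]|[]//]] /(_ i); rewrite Si. Qed.

(** Suppose [i] realises the upper bound on [r] and lies in [S], so that [u] is at least [weight i].
    If [S'] contains [j], then [v] is at least [weight j]; if [S'] is empty, [v] is at least 1/2,
    hence at least [weight i]. If the union is empty, [u] and [v] are at least 1/2 while [r] is at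
    most 1. *)
Lemma admissible_subadditive {R : realType} S S' c c' c'' (u v r : R) :
  admissible S c u -> admissible S' c' v ->
  admissible (fun i => S i || S' i) c'' r -> r <= u + v.
Proof.
have main A A' a a' (x y : R) i : admissible A a x -> admissible A' a' y -> A i ->
    (forall j, A j || A' j -> r <= weight i + weight j) -> r <= x + y.
  move=> Ax A'y Ai ri; have wx := Ax.1 i Ai.
  have [[j A'j]|NA'] := pselect (exists j, A' j).
    have wy := A'y.1 j A'j.
    by have := ri j; rewrite A'j orbT => /(_ isT); lra.
  have y2 : 1 / 2 <= y.
    by apply: (admissible_ge_half _ _ _ A'y) => j; apply/negP => A'j; apply: NA'; exists j.
  by have := ri i; rewrite Ai => /(_ isT); have := @weight_le_half R i; lra.
move=> Su S'v [_ [[i [/orP[Si|S'i] ri]]|[NS _ r1 _]]].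
- exact: (main S S' c c' u v i).
- by rewrite addrC; apply: (main S' S c' c v u i) => // j; rewrite orbC; exact: ri.
- have := admissible_ge_half _ _ _ Su; have := admissible_ge_half _ _ _ S'v.
  suff [H1 H2] : (forall i, ~~ S i) /\ (forall i, ~~ S' i).
    by move=> /(_ H2) ? /(_ H1) ?; lra.
  by split=> i; have := NS i; rewrite negb_or => /andP[].
Qed.

(** Finiteness of [S] keeps the smallest weight positive, so the admissible values fill an interval
    with interior, where a rational multiple of a basis element can be placed. *)
Lemma admissible_itv {R : realType} (S : nat -> bool) (c : rat) : 0 <= c ->
  (exists M, forall i, S i -> (i <= M)%N) ->
  exists a b : R, [/\ 0 <= a, a < b & forall u, a < u < b -> admissible S c u].
Proof.
move=> c0 [M SM]; have [[i0 Si0]|NS] := pselect (exists i, S i).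
  have [m Sm mmin] := ex_minnP (ex_intro _ i0 Si0 : exists i, S i).
  (* The least index [m] carries the largest weight, and [weight M] bounds all weights on [S] from
     below. *)
  exists (weight m), (weight m + weight M); split.
  - exact/ltW/weight_gt0.
  - by rewrite ltrDl weight_gt0.
  - move=> u /andP[au ub]; split=> [i Si|].
      by apply/ltW; apply: le_lt_trans au; exact/weight_le/mmin.
    left; exists m; split=> // j Sj; apply/ltW; apply: lt_le_trans ub _.
    by rewrite lerD2l; exact/weight_le/SM.
have {}NS i : ~~ S i by apply/negP => Si; apply: NS; exists i.
pose k : R := if 0 < c then Num.max (1 / 2) (1 - ratr c) else 1 / 2.
have kP : [/\ 1 / 2 <= k, k < 1 & 0 < c -> 1 - ratr c <= k].
  rewrite /k; case: ifP => c1; last by split=> //; lra.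
  have : 0 < ratr c :> R by rewrite ltr0q.
  by split; rewrite ?le_max ?lexx ?orbT// gt_max; apply/andP; split; lra.
have [k2 k1 kc] := kP; exists k, 1; split=> //; first lra.
move=> u /andP[ku u1]; split=> [i Si|]; first by have := NS i; rewrite Si.
by right; split=> //; [lra|lra|move=> /kc; lra].
Qed.

Lemma admissible_singleton {R : realType} n c (u : R) :
  weight n <= u <= weight n + weight n -> admissible (fun i => i == n) c u.
Proof.
move=> /andP[nu un]; split=> [i /eqP->//|].
by left; exists n; split=> // j /eqP ->.
Qed.

(** * The relation between a point and its image, with its two injections *)

Lemma rat_multiple_between {R : realType} (a b c : R) : 0 <= a -> a < b -> 0 < c ->
  exists q : rat, 0 < q /\ a < ratr q * c < b.
Proof.
move=> a0 ab c0; have : a / c < b / c by rewrite ltr_pM2r ?invr_gt0.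
move=> /rat_in_itvoo[q]; rewrite in_itv/= => /andP[aq qb]; exists q.
split; last by apply/andP; split; [rewrite -ltr_pdivrMr|rewrite -ltr_pdivlMr].
by rewrite -(ltr0q R); apply: le_lt_trans aq; rewrite divr_ge0// ltW.
Qed.

Lemma bounded_preimage (T : eqType) (e : nat -> T) (s : seq T) : injective e ->
  exists M, forall i, e i \in s -> (i <= M)%N.
Proof.
move=> eI; elim: s => [|x s [M IH]]; first by exists 0%N.
have [[k ek]|Nk] := pselect (exists k, e k = x).
  exists (maxn M k) => i; rewrite inE leq_max -ek => /orP[/eqP/eI ->|/IH ->//].
  by rewrite leqnn orbT.
exists M => i; rewrite inE => /orP[/eqP eix|/IH//].
by exfalso; apply: Nk; exists i.
Qed.

(** The weighted elements start at [e 2]: [e 0] is kept as a free direction for adjustments, and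
    [e 1] spans the ray where the excess tends to 1. *)
Definition related {R : realType} (B : set R) (e : nat -> R) (x t : R) : Prop :=
  admissible (fun i => 0 < coord B x (e i.*2.+2)) (coord B x (e 1%N)) (t - x).

(** Coordinates are nonnegative, so nothing cancels in [x + y] and its support is the union of the
    two supports. *)
Lemma related_subadditive {R : realType} (B : set R) e x y t t' t'' :
  rat_linearly_independent B -> generated_cone B x -> generated_cone B y ->
  related B e x t -> related B e y t' -> related B e (x + y) t'' -> t'' <= t + t'.
Proof.
move=> Bfree Hx Hy xt yt' xyt''.
suff : t'' - (x + y) <= (t - x) + (t' - y) by lra.
apply: (admissible_subadditive _ _ _ _ (coord B (x + y) (e 1%N)) _ _ _ xt yt').
rewrite /related in xyt''; congr admissible: xyt''; apply/funext => i.
have x0 := coord_ge0 B x (e i.*2.+2) Hx; have y0 := coord_ge0 B y (e i.*2.+2) Hy.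
by rewrite coordD//; apply/idP/orP => [|[|]]; lra.
Qed.

Lemma related_forward {R : realType} (B : set R) (e : nat -> R) :
  rat_linearly_independent B -> (forall b, B b -> 0 < b) ->
  (forall i, B (e i)) -> injective e ->
  exists g : R -> R, [/\ set_fun (generated_cone B) (generated_cone B) g,
    set_inj (generated_cone B) g & forall x, generated_cone B x -> related B e x (g x)].
Proof.
move=> Bfree B0 eB eI.
pose ok S c (q : rat) := 0 < q /\ admissible S c (ratr q * e 0%N).
(* Choosing [q] from [S] and [c] instead of [x] gives injectivity: [g] alters only the coordinate at
   [e 0], so [g x] still determines the shift. *)
pose q S c := xget 0 [set r | ok S c r].
pose S x i := 0 < coord B x (e i.*2.+2).
pose g x := x + ratr (q (S x) (coord B x (e 1%N))) * e 0%N.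
have qP x : generated_cone B x -> ok (S x) (coord B x (e 1%N)) (q (S x) (coord B x (e 1%N))).
  move=> Hx; apply: (@xgetPex _ 0 [set r | ok (S x) (coord B x (e 1%N)) r]).
  have [||a [b [a0 ab abP]]] := @admissible_itv R (S x) (coord B x (e 1%N)).
  - exact: coord_ge0.
  - have [s sP] := coord_finite_support B x.
    have [M MP] := bounded_preimage _ _ s eI.
    exists M => i /sP/MP; apply: leq_trans.
    by rewrite -addnn -!addnS leq_addr.
  - have [r [r0 rab]] := rat_multiple_between a b (e 0%N) a0 ab (B0 _ (eB _)).
    by exists r; split=> //; exact: abP.
exists g; split.
- move=> x Hx; apply: coneD => //; apply: coneZ; last exact/cone_base/eB.
  by have [] := qP x Hx.
- move=> x y /set_mem Hx /set_mem Hy gxy.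
  have He0 : generated_cone B (e 0%N) by exact/cone_base/eB.
  have coord_g z i : generated_cone B z -> coord B (g z) (e i.+1) = coord B z (e i.+1).
    move=> Hz; have [q0 _] := qP z Hz.
    rewrite coordD//; last exact: coneZ.
    rewrite coordZ// (coord_base B (e 0%N))// (_ : (e 0%N == e i.+1) = false) ?mulr0 ?addr0//.
    by apply/eqP => /eI.
  have Sxy : S x = S y by apply/funext => i; rewrite /S -(coord_g x)// -(coord_g y)// gxy.
  have cxy : coord B x (e 1%N) = coord B y (e 1%N) by rewrite -(coord_g x)// -(coord_g y)// gxy.
  by move: gxy; rewrite /g Sxy cxy => /addIr.
- move=> x Hx; have [_] := qP x Hx.
  by rewrite /related /g addrC addrA addNr add0r.
Qed.

Lemma related_backward {R : realType} (B : set R) (e : nat -> R) :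
  rat_linearly_independent B -> (forall b, B b -> 0 < b) ->
  (forall i, B (e i)) -> injective e ->
  exists h : R -> R, [/\ set_fun (generated_cone B) (generated_cone B) h,
    set_inj (generated_cone B) h & forall t, generated_cone B t -> related B e (h t) t].
Proof.
move=> Bfree B0 eB eI.
have [s [sB sI se]] := injective_shift _ B e eB eI.
have He i : generated_cone B (e i) by exact/cone_base/eB.
(* As [s] avoids [e 0], the coordinate of [y t] there is exactly 1, so a factor [r] can be read off
   [r * y t]. *)
pose y t := cone_map B s t + e 0%N.
have Hy t : generated_cone B t -> generated_cone B (y t) by move=> Ht; apply: coneD; [exact: cone_map_cone|exact: He].
have parts t : exists z : rat * rat * nat, generated_cone B t -> [/\ 0 < z.1.1, 0 < z.1.2 &
    weight z.2 <= t - (ratr z.1.1 * y t + ratr z.1.2 * e z.2.*2.+2) <= weight z.2 + weight z.2].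
  have [Ht|NHt] := pselect (generated_cone B t); last by exists (0, 0, 0%N).
  have t0 : 0 < t by exact: cone_gt0 Ht.
  have [n nt] := weight_lt _ t0; have n0 := @weight_gt0 R n.
  have y0 : 0 < y t by apply: cone_gt0 (Hy t Ht).
  (* The target for [r * y t + q * e n.*2.+2] is the interval from [t - 2 * weight n] to
     [t - weight n], cut off at 0. First [r * y t] is made shorter than this interval, then [q]
     fills the remainder. *)
  pose a := Num.max 0 (t - 2 * weight n).
  have [a0 ta] : 0 <= a /\ t - 2 * weight n <= a.
    by split; rewrite le_max lexx ?orbT.
  have an : a < t - weight n by rewrite gt_max; apply/andP; split; lra.
  have [||r [r0 /andP[ry ry']]] := rat_multiple_between 0 (t - weight n - a) (y t) _ _ y0; [by []|lra|].
  pose a' := Num.max 0 (a - ratr r * y t).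
  have [a'0 aa'] : 0 <= a' /\ a - ratr r * y t <= a'.
    by split; rewrite le_max lexx ?orbT.
  have a'n : a' < t - weight n - ratr r * y t by rewrite gt_max; apply/andP; split; lra.
  have [q [q0 /andP[qe qe']]] := rat_multiple_between a' _ (e n.*2.+2) a'0 a'n (B0 _ (eB _)).
  by exists (r, q, n) => _; split=> //=; apply/andP; split; lra.
have [z zP] := choice parts.
pose h t := ratr (z t).1.1 * y t + ratr (z t).1.2 * e (z t).2.*2.+2.
have coord_h t b : generated_cone B t -> coord B (h t) b = (z t).1.1 * (coord B (cone_map B s t) b + (e 0%N == b)%:R)
    + (z t).1.2 * (e (z t).2.*2.+2 == b)%:R.
  move=> Ht; have [r0 q0 _] := zP t Ht.
  have Hyt := Hy t Ht; have Hs := cone_map_cone B s t sB Ht.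
  rewrite coordD ?coordZ//; try exact: coneZ.
  by rewrite (coordD B (cone_map B s t))// !(coord_base B (e _)).
have coord_even t i : generated_cone B t -> coord B (cone_map B s t) (e i.*2) = 0.
  by move=> Ht; apply: coord_cone_map0 => // b _; exact: se.
have e_eq i j : (e i == e j) = (i == j) by apply/eqP/eqP => [/eI|->].
exists h; split.
- move=> t Ht; have [r0 q0 _] := zP t Ht.
  by apply: coneD; apply: coneZ => //; exact: Hy.
- move=> t t' /set_mem Ht /set_mem Ht' hE.
  have [r0 _ _] := zP t Ht.
  have rE : (z t).1.1 = (z t').1.1.
    have := congr1 (fun x => coord B x (e 0%N)) hE.
    by rewrite !coord_h// !(coord_even _ 0%N)// !e_eq/= !mulr0 !addr0 add0r !mulr1.
  (* The coordinate of [h t] at [s b] is [r] times that of [t] at [b], since [s b] is no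
     even-indexed [e i]. *)
  apply: (coord_inj B) => // b Bb.
  have := congr1 (fun x => coord B x (s b)) hE.
  have es i : (e i.*2 == s b) = false by apply/eqP => /esym/se.
  rewrite !coord_h// !coord_cone_map// (es 0%N) -!doubleS !es !mulr0 !addr0 -rE.
  by move=> /mulfI; apply; rewrite gt_eqF.
- move=> t Ht; have [r0 q0 tP] := zP t Ht; rewrite /related.
  have -> : (fun i => 0 < coord B (h t) (e i.*2.+2)) = (fun i => i == (z t).2).
    apply/funext => i; rewrite coord_h// -!doubleS coord_even// !e_eq/= add0r mulr0 add0r.
    rewrite (inj_eq double_inj) eqSS eq_sym.
    by case: eqP => _; rewrite ?mulr1 ?mulr0 ?ltxx.
  exact: admissible_singleton.
Qed.

(** * The bijection and its behaviour along two rays *)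

Theorem theorem1p7 (R : realType) (H B : set R)
    (Hcone : positive_rational_cone H)
    (Bpos : forall b, B b -> 0 < b)
    (Binf : infinite_set B)
    (Bfree : rat_linearly_independent B)
    (HgenB : H = generated_cone B) :
  exists f : R -> R,
    [/\ set_bij H H f,
        subadditive_on H f,
        limf_einf (fun x : R => (f x)%:E) (within H (nbhs (0 : R))) = 0%E
      & limf_esup (fun x : R => (f x)%:E) (within H (nbhs (0 : R))) = 1%E].
Proof.
have [e eB eI] : exists2 e : nat -> R, forall i, B (e i) & injective e.
  have /infiniteP/pcard_leP[e] := Binf.
  by exists e => [i|i j]; [exact: funS|apply: inj; rewrite inE].
have [g [gH gI gP]] := related_forward B e Bfree Bpos eB eI.
have [h [hH hI hP]] := related_backward B e Bfree Bpos eB eI.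
have [f f_bij fP] := Cantor_Bernstein_rel _ _ _ _ _ gH gI gP hH hI hP.
have H0 x : H x -> 0 < x by rewrite HgenB; exact: cone_gt0.
have fH x : H x -> H (f x) by rewrite HgenB; have [+ _ _] := f_bij; apply.
have small i d : 0 < d -> exists r : rat, [/\ 0 < r, H (ratr r * e i),
    ratr r < d & ratr r * e i < d].
  move=> d0; have ei0 := Bpos _ (eB i).
  (* A multiple of [1 + e i] below [d] bounds both [r] and [r * e i]. *)
  have [|r [r0 /andP[_ rd]]] := rat_multiple_between 0 d (1 + e i) (lexx _) d0; first by lra.
  have r0' : 0 < ratr r :> R by rewrite ltr0q.
  have rei : 0 < ratr r * e i by rewrite mulr_gt0.
  exists r; split=> //; last 2 first.
  - lra.
  - lra.
  by rewrite HgenB; apply: coneZ => //; exact: cone_base.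
have coord_ray i r j : 0 < r -> coord B (ratr r * e i) (e j) = r * (i == j)%:R.
  move=> r0; rewrite coordZ//; last exact: cone_base.
  by rewrite coord_base//; congr (_ * (_ : bool)%:R); apply/eqP/eqP => [/eI|->].
exists f; split.
- by rewrite HgenB.
- move=> x y; rewrite HgenB => Hx Hy.
  by apply: related_subadditive (fP _ Hx) (fP _ Hy) (fP _ (coneD _ _ _ Hx Hy)).
- apply: limf_einf_cone_eq0 => // [x Hx|d d0]; first exact/ltW/H0/fH.
  (* On the ray of [e n.*2.+2] the support is [n] alone, so [f x] is at most [x + 2 * weight n], a
     sum of three terms below [d / 3]. *)
  have d3 : 0 < d / 3 by lra.
  have [n nd] := weight_lt _ d3.
  have [r [r0 Hr _ rd]] := small n.*2.+2 _ d3.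
  exists (ratr r * e n.*2.+2); split=> //; first lra.
  have := fP (ratr r * e n.*2.+2); rewrite -HgenB => /(_ Hr)[_ [[i [+ fi]]|[/(_ n)]]].
    rewrite coord_ray//; case: eqP => [[/double_inj ni] _|_]; last by rewrite mulr0 ltxx.
    by have := fi n; rewrite -ni coord_ray// eqxx mulr1 => /(_ r0); lra.
  by rewrite coord_ray// eqxx mulr1 r0.
- apply: limf_esup_cone_eq1 => // [x Hx|d d0].
    have := fP x; rewrite -HgenB => /(_ Hx)/admissible_le1; lra.
  (* On the ray of [e 1] the weighted support is empty and the coordinate is [r], so the excess is
     at least [1 - r], which exceeds [1 - d]. *)
  have [r [r0 Hr rd red]] := small 1%N d d0.
  exists (ratr r * e 1%N); split=> //.
  have := fP (ratr r * e 1%N); rewrite -HgenB => /(_ Hr)[_ [[i [+ _]]|[_ _ _]]].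
    by rewrite coord_ray// mulr0 ltxx.
  rewrite coord_ray// mulr1 => /(_ r0).
  have := H0 _ Hr; lra.
Qed.
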